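(* The networked system with node dynamics $$\dot x_i=A_ix_i+\sum_{j=1}^N\beta_{ij}H_iy_j+\delta_iB_iu_i,\qquad y_i=C_ix_i,\qquad 1\le i\le N,$$ is observable (i.e. $(\mathcal{C},\mathcal{A})$ is an observable pair) if and only if $(C_i,A_i)$ is an observable pair for every $1\le i\le N$.
   Context: Here $A_i\in\mathbb{R}^{n_i\times n_i}$, $B_i\in\mathbb{R}^{n_i\times p_i}$, $C_i\in\mathbb{R}^{m\times n_i}$, $H_i\in\mathbb{R}^{n_i\times m}$, $\delta_i\in\{0,1\}$ for $1\le i\le N$, and $\beta_{ij}\in\mathbb{R}$ for $1\le i,j\le N$, where $\beta_{ij}\ne 0$ if and only if there is an edge from node $j$ to node $i$. In compact form the networked system is $\dot X=\mathcal{A}X+\mathcal{B}U$, $Y=\mathcal{C}X$, where $\mathcal{A}=\mathrm{blockdiag}\{A_1,\dots,A_N\}+(\beta_{ij}H_iC_j)_{i,j=1}^N$, $\mathcal{B}=\mathrm{blockdiag}\{\delta_1B_1,\dots,\delta_NB_N\}$, $\mathcal{C}=\mathrm{blockdiag}\{C_1,\dots,C_N\}$. A linear system $\dot x=Ax+Bu$, $y=Cx$ with $A\in\mathbb{R}^{n\times n}$ (equivalently the pair $(C,A)$) is observable if for any $x(t_0)=x_0$ there is a finite time $t_f$ such that knowledge of the input $u(t)$ and output $y(t)$ on $[t_0,t_f]$ uniquely determines $x_0$; equivalently the matrix obtained by stacking $C,CA,\dots,CA^{n-1}$ has rank $n$. *)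

(* Defs.v *)
From mathcomp Require Import all_boot all_order all_algebra.
From mathcomp Require Import all_classical all_reals all_analysis.
Set Implicit Arguments.
Unset Strict Implicit.
Unset Printing Implicit Defensive.
Import Order.TTheory GRing.Theory Num.Theory.
Import numFieldNormedType.Exports.
Local Open Scope classical_set_scope.
Local Open Scope ring_scope.

(* Vector-valued continuity and derivatives are taken coordinatewise, since
   'cV_n has no norm in the library when n is not syntactically a successor.
   The derivative is only required in the open interval, which together with
   continuity up to the end points is the usual notion on a closed interval. *)
Definition trajectory (R : realType) (n p : nat) (A : 'M[R]_n)
    (B : 'M[R]_(n, p)) (t0 tf : R) (u : R -> 'cV[R]_p) (x : R -> 'cV[R]_n) :=
  (forall k : 'I_n, {within `[t0, tf], continuous (fun s : R => x s k 0)}) /\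
  (forall (t : R) (k : 'I_n), t0 < t < tf ->
     is_derive t (1 : R) (fun s : R => x s k 0) ((A *m x t + B *m u t) k 0)).

(* [tf] depends on the initial time and state only, not on the input. *)
Definition observable (R : realType) (n p m : nat) (A : 'M[R]_n)
    (B : 'M[R]_(n, p)) (C : 'M[R]_(m, n)) :=
  forall (t0 : R) (x0 : 'cV[R]_n), exists2 tf : R, t0 < tf &
  forall (u : R -> 'cV[R]_p) (x z : R -> 'cV[R]_n),
    trajectory A B t0 tf u x -> trajectory A B t0 tf u z -> x t0 = x0 ->
    (forall t : R, t0 <= t <= tf -> C *m x t = C *m z t) ->
    z t0 = x0.

(* Observability does not depend on the input matrix: see [observableP]. *)
Definition observable_pair (R : realType) (n m : nat) (C : 'M[R]_(m, n))
    (A : 'M[R]_n) :=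
  forall (p : nat) (B : 'M[R]_(n, p)), observable A B C.

Lemma trajectory_sub (R : realType) (n p q : nat) (A : 'M[R]_n)
    (B : 'M[R]_(n, p)) (B' : 'M[R]_(n, q)) (t0 tf : R) (u : R -> 'cV[R]_p)
    (x z : R -> 'cV[R]_n) :
  trajectory A B t0 tf u x -> trajectory A B t0 tf u z ->
  trajectory A B' t0 tf (fun=> 0) (fun s => x s - z s).
Proof.
have subE k : (fun s => (x s - z s) k 0) =
    ((fun s => x s k 0) - (fun s => z s k 0) : R -> R).
  by apply/funext => s; rewrite !mxE.
move=> [cx dx] [cz dz]; split=> [k|t k tP]; rewrite subE.
  by move=> s; apply: continuousB; [exact: cx|exact: cz].
have -> : (A *m (x t - z t) + B' *m 0) k 0 =
    (A *m x t + B *m u t) k 0 - (A *m z t + B *m u t) k 0.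
  by rewrite mulmx0 addr0 mulmxBr !mxE opprD addrACA subrr addr0.
by apply: is_deriveB; [exact: dx|exact: dz].
Qed.

Lemma trajectory0 (R : realType) (n p : nat) (A : 'M[R]_n) (B : 'M[R]_(n, p))
    (t0 tf : R) : trajectory A B t0 tf (fun=> 0) (fun=> 0).
Proof.
split=> [k|t k _]; first by move=> s; exact: cst_continuous.
rewrite !mulmx0 addr0 [X in is_derive _ _ _ X]mxE.
exact: (@is_derive_cst R R R).
Qed.

Lemma observableP (R : realType) (n p m : nat) (A : 'M[R]_n)
    (B : 'M[R]_(n, p)) (C : 'M[R]_(m, n)) :
  observable A B C <-> observable_pair C A.
Proof.
split=> [obs q B' t0 x0|]; last exact.
have [tf t0f uniq] := obs t0 0; exists tf => // u x z tx tz <- yE.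
apply/esym/eqP; rewrite -subr_eq0; apply/eqP.
apply: (uniq _ _ _ (trajectory0 _ _ _ _) (trajectory_sub B tx tz)) => // t /yE.
by rewrite mulmx0 mulmxBr => ->; rewrite subrr.
Qed.

(* Rectangular-block analogue of [mxdiag]; [conform_mx] only serves to retype
   [D i] as the block of index (i, j) when i = j. *)
Definition blockdiag (R : realType) (N : nat) (r c : 'I_N -> nat)
    (D : forall i : 'I_N, 'M[R]_(r i, c i)) :
    'M[R]_(\sum_i r i, \sum_j c j) :=
  \mxblock_(i, j) if i == j then conform_mx 0 (D i) else 0.

Definition netA (R : realType) (N m : nat) (n : 'I_N -> nat)
    (A : forall i, 'M[R]_(n i)) (C : forall i, 'M[R]_(m, n i))
    (H : forall i, 'M[R]_(n i, m)) (beta : 'I_N -> 'I_N -> R) :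
    'M[R]_(\sum_i n i) :=
  \mxdiag_i A i + \mxblock_(i, j) (beta i j *: (H i *m C j)).

Definition netB (R : realType) (N : nat) (n p : 'I_N -> nat)
    (B : forall i, 'M[R]_(n i, p i)) (delta : 'I_N -> bool) :
    'M[R]_(\sum_i n i, \sum_i p i) :=
  blockdiag (fun i => (delta i)%:R *: B i).

Definition netC (R : realType) (N m : nat) (n : 'I_N -> nat)
    (C : forall i, 'M[R]_(m, n i)) : 'M[R]_(\sum_(i < N) m, \sum_i n i) :=
  blockdiag C.

Lemma submxcol_mul_blockdiag (R : realType) (N : nat) (r c : 'I_N -> nat)
    (D : forall i : 'I_N, 'M[R]_(r i, c i)) (x : 'cV[R]_(\sum_i c i)) (i : 'I_N) :
  submxcol (blockdiag D *m x) i = D i *m submxcol x i.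
Proof.
rewrite -{1}[x]submxcolK /blockdiag mul_mxblock_mxrow mxcolK.
rewrite (bigD1 i) //= eqxx conform_mx_id.
by rewrite big1 ?addr0 // => j ji; rewrite eq_sym (negPf ji) mul0mx.
Qed.

(* The compact form restricted to node i is the node dynamics with
   y_j = C_j x_j. *)
Lemma submxcol_net_dynamics (R : realType) (N m : nat) (n p : 'I_N -> nat)
    (A : forall i : 'I_N, 'M[R]_(n i)) (B : forall i, 'M[R]_(n i, p i))
    (C : forall i, 'M[R]_(m, n i)) (H : forall i, 'M[R]_(n i, m))
    (delta : 'I_N -> bool) (beta : 'I_N -> 'I_N -> R)
    (x : 'cV[R]_(\sum_i n i)) (u : 'cV[R]_(\sum_i p i)) (i : 'I_N) :
  submxcol (netA A C H beta *m x + netB B delta *m u) i =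
    A i *m submxcol x i
    + \sum_j beta i j *: (H i *m (C j *m submxcol x j))
    + (delta i)%:R *: (B i *m submxcol u i).
Proof.
rewrite submxcolD submxcol_mul_blockdiag -scalemxAl; congr (_ + _).
rewrite mulmxDl submxcolD [\mxdiag_i0 _](_ : _ = blockdiag A) //.
rewrite submxcol_mul_blockdiag; congr (_ + _).
rewrite -{1}[x]submxcolK mul_mxblock_mxrow mxcolK; apply: eq_bigr => j _.
by rewrite -scalemxAl mulmxA.
Qed.

(* Main.v *)
Require Import Defs.
From mathcomp Require Import all_boot all_order all_algebra.
From mathcomp Require Import all_classical all_reals all_analysis.
Import Order.TTheory GRing.Theory Num.Theory.
Import numFieldNormedType.Exports.
Local Open Scope ring_scope.

Set Implicit Arguments.
Unset Strict Implicit.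

(** By linearity, a system is observable exactly when, over some time interval
    that depends only on its left end, every trajectory with zero input and
    zero output starts at 0 ([observable_silentP]).  The nodes of the network
    interact only through their outputs.  Hence, along a trajectory on which
    all outputs vanish, every coupling term [beta i j *: (H i *m C j *m x_j)]
    vanishes too and the network is a juxtaposition of uncoupled nodes: the
    silent trajectories of the network are exactly the families of silent
    trajectories of its nodes ([silent_net]).

    If every node is observable, a silent trajectory of the network, over an
    interval long enough for all the nodes, has all its components starting
    at 0.  If the network is observable, a silent trajectory of one node,
    completed by 0 at the other nodes, is a silent trajectory of the network,
    so it starts at 0. *)

(** The input matrix has no columns, so that the trajectories are those of the
    autonomous equation x' = A x. *)
Definition silent (R : realType) (n m : nat) (A : 'M[R]_n) (C : 'M[R]_(m, n))
    (t0 tf : R) (x : R -> 'cV[R]_n) :=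
  trajectory A (0 : 'M[R]_(n, 0)) t0 tf (fun=> 0) x /\
  (forall t, t0 <= t <= tf -> C *m x t = 0).

Lemma silent0 (R : realType) (n m : nat) (A : 'M[R]_n) (C : 'M[R]_(m, n))
    (t0 tf : R) : silent A C t0 tf (fun=> 0).
Proof. by split=> [|t _]; [exact: trajectory0|rewrite mulmx0]. Qed.

Lemma silent_shorten (R : realType) (n m : nat) (A : 'M[R]_n)
    (C : 'M[R]_(m, n)) (t0 t1 tf : R) (x : R -> 'cV[R]_n) :
  t1 <= tf -> silent A C t0 tf x -> silent A C t0 t1 x.
Proof.
move=> t1f [[cx dx] yx]; split; [split=> [k|t k /andP[t0t tt1]]|].
- apply: continuous_subspaceW (cx k) => t /=; rewrite !in_itv/= => /andP[-> tt1].
  exact: le_trans tt1 t1f.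
- by apply: dx; rewrite t0t (lt_le_trans tt1 t1f).
- by move=> t /andP[t0t tt1]; apply: yx; rewrite t0t (le_trans tt1 t1f).
Qed.

(** Two trajectories with the same input and the same output differ by a
    silent one; conversely a silent trajectory is one that the input and the
    output do not distinguish from 0. *)
Lemma observable_silentP (R : realType) (n p m : nat) (A : 'M[R]_n)
    (B : 'M[R]_(n, p)) (C : 'M[R]_(m, n)) :
  observable A B C <->
  forall t0 : R, exists2 tf, t0 < tf &
    forall x, silent A C t0 tf x -> x t0 = 0.
Proof.
split=> [/observableP obs t0|obs t0 x0].
  have [tf t0f uniq] := obs 0 (0 : 'M[R]_(n, 0)) t0 0; exists tf => // x [tx yx].
  apply: (uniq _ _ _ (trajectory0 _ _ _ _) tx) => // t /yx ->.
  by rewrite mulmx0.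
have [tf t0f null] := obs t0; exists tf => // u x z tx tz <- yE.
apply/esym/eqP; rewrite -subr_eq0; apply/eqP.
apply: (null (fun s => x s - z s)); split=> [|t /yE yt].
  exact: trajectory_sub tx tz.
by rewrite mulmxBr yt subrr.
Qed.

Lemma netC_mul_eq0 (R : realType) (N m : nat) (n : 'I_N -> nat)
    (C : forall i, 'M[R]_(m, n i)) (v : 'cV[R]_(\sum_i n i)) :
  netC C *m v = 0 <-> forall i, C i *m submxcol v i = 0.
Proof.
split=> [yv i|yv].
  by rewrite -submxcol_mul_blockdiag [X in submxcol X]yv submxcol0.
by apply/mxcolP => i; rewrite submxcol0 submxcol_mul_blockdiag.
Qed.

(** The coupling enters each node through the outputs only, so it disappears
    at the states with zero output. *)
Lemma submxcol_netA_silent (R : realType) (N m : nat) (n : 'I_N -> nat)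
    (A : forall i, 'M[R]_(n i)) (C : forall i, 'M[R]_(m, n i))
    (H : forall i, 'M[R]_(n i, m)) (beta : 'I_N -> 'I_N -> R)
    (v : 'cV[R]_(\sum_i n i)) (i : 'I_N) :
  netC C *m v = 0 -> submxcol (netA A C H beta *m v) i = A i *m submxcol v i.
Proof.
move=> /netC_mul_eq0 yv.
have := submxcol_net_dynamics A (fun i => 0 : 'M[R]_(n i, 0)) C H xpred0 beta v
  0 i.
rewrite mulmx0 addr0 scale0r addr0 => ->.
by rewrite [X in _ + X]big1 ?addr0 // => j _; rewrite yv mulmx0 scaler0.
Qed.

(** A state of the network has zero output exactly when each of its blocks
    has, and then the two equations of motion agree block by block. *)
Lemma silent_net (R : realType) (N m : nat) (n : 'I_N -> nat)
    (A : forall i, 'M[R]_(n i)) (C : forall i, 'M[R]_(m, n i))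
    (H : forall i, 'M[R]_(n i, m)) (beta : 'I_N -> 'I_N -> R)
    (t0 tf : R) (x : R -> 'cV[R]_(\sum_i n i)) :
  silent (netA A C H beta) (netC C) t0 tf x <->
  forall i, silent (A i) (C i) t0 tf (fun s => submxcol (x s) i).
Proof.
have coordE i (k : 'I_(n i)) :
    (fun s => submxcol (x s) i k 0) = (fun s => x s (tagnat.Rank i k) 0).
  by apply/funext => s; rewrite mxE.
have fieldE t i (k : 'I_(n i)) : netC C *m x t = 0 ->
    (A i *m submxcol (x t) i + (0 : 'M[R]_(n i, 0)) *m 0) k 0 =
    (netA A C H beta *m x t + (0 : 'M[R]_(_, 0)) *m 0) (tagnat.Rank i k) 0.
  by move=> yt; rewrite !mulmx0 !addr0 -(submxcol_netA_silent A H beta i yt) mxE.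
have closed t : t0 < t < tf -> t0 <= t <= tf.
  by move=> /andP[/ltW -> /ltW ->].
split=> [[[cx dx] yx] i|sx].
  split; [split=> [k|t k tP]|by move=> t /yx /netC_mul_eq0].
    by rewrite coordE; exact: cx.
  by rewrite coordE fieldE; [exact: dx|exact/yx/closed].
have yx t : t0 <= t <= tf -> netC C *m x t = 0.
  by move=> tP; apply/netC_mul_eq0 => i; have [_] := sx i; exact.
split=> //; split=> [k|t k tP]; rewrite -[k]tagnat.sig2K -?coordE -?fieldE.
- by have [[cx _] _] := sx (tagnat.sig1 k); exact: cx.
- by have [[_ dx] _] := sx (tagnat.sig1 k); exact: dx.
- exact/yx/closed.
Qed.

Unset Implicit Arguments.

Theorem theorem4p4 (R : realType) (N m : nat) (n p : 'I_N -> nat)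
    (A : forall i : 'I_N, 'M[R]_(n i))
    (B : forall i : 'I_N, 'M[R]_(n i, p i))
    (C : forall i : 'I_N, 'M[R]_(m, n i))
    (H : forall i : 'I_N, 'M[R]_(n i, m))
    (delta : 'I_N -> bool)
    (edge : rel 'I_N) (* [edge j i]: there is an edge from j to i *)
    (beta : 'I_N -> 'I_N -> R)
    (hbeta : forall i j : 'I_N, beta i j <> 0 <-> edge j i) :
  observable (netA A C H beta) (netB B delta) (netC C) <->
  (forall i : 'I_N, observable_pair (C i) (A i)).
Proof.
split=> [/observable_silentP obs i q D|obs].
  apply/observable_silentP => t0.
  have [tf t0f null] := obs t0; exists tf => // x sx.
  (* The trajectory of node i, completed by 0 at the other nodes; conform_mx
     retypes x s as block j, where j = i. *)
  pose X s := \mxcol_j (if j == i then conform_mx 0 (x s) else 0) :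
    'cV[R]_(\sum_j n j).
  have Xi s : submxcol (X s) i = x s by rewrite mxcolK eqxx conform_mx_id.
  rewrite -Xi null ?submxcol0//; apply/silent_net => j.
  have [->|ji] := eqVneq j i.
    by rewrite (_ : (fun s => _) = x)//; apply/funext.
  rewrite (_ : (fun s => _) = (fun=> 0)); first exact: silent0.
  by apply/funext => s; rewrite mxcolK (negPf ji).
apply/observable_silentP => t0.
have /choice[tf tfP] i : exists tf, t0 < tf /\
    forall x, silent (A i) (C i) t0 tf x -> x t0 = 0.
  by have /observable_silentP/(_ t0)[tf] := obs i 0%N 0; exists tf.
(* Starting the maximum at t0 + 1 keeps the interval nontrivial if N = 0. *)
exists (\big[Order.max/t0 + 1]_i tf i) => [|x /silent_net sx].
  by apply: lt_le_trans (bigmax_ge_id _ _ _ _); rewrite ltrDl.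
apply/mxcolP => i; rewrite submxcol0.
have [_ null] := tfP i.
apply: (null (fun s => submxcol (x s) i)).
exact: silent_shorten (le_bigmax _ _ i) (sx i).
Qed.
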